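(* For a finite set $D$ of cells $(i,j)$ (row $i$ from top, column $j$ from left) with $|D|=N$, a standard filling of $D$ is a bijection $T:D\to\{1,\dots,N\}$ such that $T(i,j)<T(i,j')$ whenever $(i,j),(i,j')\in D$ with $j<j'$, and $T(i,j)<T(i',j)$ whenever $(i,j),(i',j)\in D$ with $i<i'$ (i.e. entries increase along every row and down every column, comparing all cells of $D$ in that row/column). Then: (1) For integers $m\ge1$, $0\le k\le m$, let $D$ consist of $m$ cells $(1,1),\dots,(1,m)$ in row 1, $m+1$ cells $(2,1),\dots,(2,m+1)$ in row 2, and $m-k$ cells $(3,1),\dots,(3,m-k)$ in row 3 (the shape $(m+1,m+1,m-k)$ with its north-east corner cell removed). The number of standard fillings of $D$ is $$f_{m,m+1,m-k}=\binom{3m-k+1}{m,\ m+1,\ m-k}\frac{(k+2)^2(2m+1)+(m+2)}{(m+1)(m+2)(2m+1)(2m+3)}.$$ (2) For integers $m\ge2$, $k\ge0$, let $D$ consist of cells $(1,1),\dots,(1,m+k)$, $(2,1),\dots,(2,m-1)$, $(3,1),\dots,(3,m)$ (the shape $(m+k,m,m)$ with the last cell of the second row removed). The number of standard fillings of $D$ is $$f_{m+k,m-1,m}=\frac{1}{(2m-1)(2m-3)}\left[\frac{(k+2)^2(2m-3)+m}{(m+k+2)(m+k+1)}\binom{3m+k-1}{m+k,\ m-1,\ m}-\frac{3}{3m-1}\binom{3m-1}{m+1,\ m-2,\ m}\right].$$ (3) For an integer $m\ge0$, let $D$ consist of cells $(1,1),\dots,(1,m+3)$, $(2,1),(2,3)$,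 $(3,1),(3,2),(3,3)$ (the shape $(m+3,3,3)$ with the middle cell of the second row removed). The number of standard fillings of $D$ is $$f_{m+3,2,3}(-1)=\frac{m+5}{10}\binom{m+2}{2}\binom{m+9}{2}.$$
   Context: $\binom{a}{b,c,d}=\frac{a!}{b!\,c!\,d!}$ denotes the multinomial coefficient (with $b+c+d=a$). In part (3) the column condition applies across the removed cell: the entry in cell $(1,2)$ must be smaller than the entry in cell $(3,2)$. *)

(* Defs.v *)
From HB Require Import structures.
From mathcomp Require Import all_boot all_order all_algebra finmap.

Set Implicit Arguments.
Unset Strict Implicit.
Unset Printing Implicit Defensive.

Import Order.TTheory GRing.Theory Num.Theory.

(* The cell (i, j) lies in row i from the top and column j from the left;
   both coordinates start at 1. *)
Definition cell : Type := (nat * nat)%type.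

Definition row_cells (i : nat) (cols : seq nat) : seq cell :=
  [seq (i, j) | j <- cols].

(* Left-justified rows of lengths a, b, c, from top to bottom. *)
Definition rows3 (a b c : nat) : {fset cell} :=
  [fset x in row_cells 1 (iota 1 a) ++ row_cells 2 (iota 1 b)
             ++ row_cells 3 (iota 1 c)]%fset.

(* The shape (a, 3, 3) with the cell (2, 2) removed. *)
Definition rows3_hole (a : nat) : {fset cell} :=
  [fset x in row_cells 1 (iota 1 a) ++ row_cells 2 [:: 1; 3]
             ++ row_cells 3 [:: 1; 2; 3]]%fset.

(* 'I_#|` D|.+1 is {0, ..., N} with N = |D|; the entries are the nonzero
   elements. *)
Definition standard_filling (D : {fset cell})
    (T : {ffun D -> 'I_#|` D|.+1}) : bool :=
  [&& injectiveb T,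
      [set T x | x : D] == [set v : 'I_#|` D|.+1 | 1 <= v],
      [forall x : D, forall y : D,
        ((val x).1 == (val y).1) && ((val x).2 < (val y).2) ==> (T x < T y)]
    & [forall x : D, forall y : D,
        ((val x).2 == (val y).2) && ((val x).1 < (val y).1) ==> (T x < T y)]].

Definition num_fillings (D : {fset cell}) : nat :=
  #|[set T : {ffun D -> 'I_#|` D|.+1} | standard_filling T]|.

(* Meaningful for b + c + d = a. *)
Definition multinomial3 (a b c d : nat) : rat :=
  (a`!%:R / (b`!%:R * c`!%:R * d`!%:R))%R.

(* Main.v *)
(* The largest entry of a standard filling sits in a cell with nothing to its
   right and nothing below it, and erasing that cell leaves a standard filling
   of the smaller shape; so the number of fillings of D is the sum, over the
   maximal cells x of D, of the number of fillings of D \ x.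

   For a straight shape this recursion gives the hook formula.  In
   (m, m + 1, c) with c <= m the maximal cells are (2, m + 1) and, when c > 0,
   (3, c), so its count is the sum over i <= c of the counts of (m, m, i).
   In (a, m - 1, m) with a >= m they are (3, m) and, when a > m, (1, a), so its
   count is the sum over m <= i <= a of the counts of (i, m - 1, m - 1).  Both
   closed forms follow by induction.  For the shape with the hole, removing
   cells of the last two rows one by one gives polynomials in m. *)

Require Import Defs.
From HB Require Import structures.
From mathcomp Require Import all_boot all_order all_algebra finmap.
From mathcomp Require Import ring lra zify.

Set Implicit Arguments.
Unset Strict Implicit.
Unset Printing Implicit Defensive.

Import Order.TTheory GRing.Theory Num.Theory.
Local Open Scope fset_scope.

(** * Comparable cells and standard fillings *)

Definition prec (x y : cell) : bool :=
  (x.1 == y.1) && (x.2 < y.2) || (x.2 == y.2) && (x.1 < y.1).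

(** [prec] relates cells of a common row or column, adjacent or not, so a cell further on blocks [x]
    even across a gap of [D]. *)
Definition maximal_cell (D : {fset cell}) (x : cell) : bool :=
  (x \in D) && [forall y : D, ~~ prec x (val y)].

Lemma maximal_cellP (D : {fset cell}) (x : cell) :
  reflect (x \in D /\ forall y, y \in D -> ~~ prec x y) (maximal_cell D x).
Proof.
apply: (iffP andP) => -[xD maxx]; split=> //.
  by move=> y yD; exact: (forallP maxx [` yD]).
by apply/forallP => y; apply/maxx/valP.
Qed.

Section Fillings.
Variable D : {fset cell}.
Local Notation fillingT := {ffun D -> 'I_#|` D|.+1}.

Lemma card_pos_ord n : #|[set v : 'I_n.+1 | 1 <= v]| = n.
Proof.
have -> : [set v : 'I_n.+1 | 1 <= v] = [set~ ord0].
  by apply/setP => v; rewrite !inE -val_eqE /= lt0n.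
by rewrite cardsC1 card_ord.
Qed.

Lemma standard_fillingP (T : fillingT) :
  reflect [/\ injective T, forall x, 0 < T x
            & forall x y, prec (val x) (val y) -> T x < T y]
          (standard_filling T).
Proof.
apply: (iffP and4P) => [[/injectiveP injT /eqP imT rowT colT] | [injT posT incT]].
  split=> // [x | x y /orP[] lexy].
  - have : T x \in [set T z | z : D] by exact: imset_f.
    by rewrite imT inE.
  - exact: (implyP (forallP (forallP rowT x) y)).
  - exact: (implyP (forallP (forallP colT x) y)).
split; first exact/injectiveP.
(* Surjectivity is free: an injective [T] has [#|D|] values, and there are exactly [#|D|] positive
   entries. *)
- rewrite eqEcard card_pos_ord card_imset // andbC [X in X <= _]cardfE leqnn.
  by apply/subsetP => _ /imsetP[x _ ->]; rewrite inE.
- apply/forallP => x; apply/forallP => y; apply/implyP => lexy.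
  by apply: incT; rewrite /prec lexy.
- apply/forallP => x; apply/forallP => y; apply/implyP => lexy.
  by apply: incT; rewrite /prec lexy orbT.
Qed.

Lemma standard_filling_onto (T : fillingT) (v : 'I_#|` D|.+1) :
  standard_filling T -> 0 < v -> exists x, T x = v.
Proof.
case/and4P=> _ /eqP imT _ _ v0.
have : v \in [set T x | x : D] by rewrite imT inE.
by case/imsetP=> x _ ->; exists x.
Qed.

End Fillings.

(** * Removing a maximal cell that holds the largest entry *)

Section RemoveMaximal.
Variables (D : {fset cell}) (x0 : cell).
Hypothesis maxx : maximal_cell D x0.
Let D' := D `\ x0.
Let x0D : x0 \in D. Proof. by case/andP: maxx. Qed.
Let x : D := [` x0D].

Let cardD : #|` D| = #|` D'|.+1.
Proof. by rewrite (cardfsD1 x0) x0D. Qed.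

Let inclP (y : D') : val y \in D.
Proof. by case/fsetD1P: (valP y). Qed.
Let incl (y : D') : D := [` inclP y].

Let in_D' (y : D) : y != x -> val y \in D'.
Proof. by move=> neq; rewrite !inE (valP y) andbT; exact: neq. Qed.

(** [insub] fails only at [x0], which therefore receives the new largest entry; [inord] just moves
    the other values to the larger ordinal type. *)
Definition extend_filling (T : {ffun D' -> 'I_#|` D'|.+1}) :
    {ffun D -> 'I_#|` D|.+1} :=
  [ffun y : D => if insub (val y) is Some y' then inord (T y') else ord_max].

(** [inord] would send the value [#|D|] to 0, so this is meaningful only when [T] takes that value
    at [x0] alone. *)
Definition restrict_filling (T : {ffun D -> 'I_#|` D|.+1}) :
    {ffun D' -> 'I_#|` D'|.+1} :=
  [ffun y : D' => inord (T (incl y))].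

Let extendE T (y : D') : extend_filling T (incl y) = T y :> nat.
Proof.
rewrite ffunE; case: insubP => [u _ eu | ].
  have -> : u = y by apply: val_inj.
  by rewrite inordK // cardD ltnW // ltnS.
by rewrite (valP y).
Qed.

Let extend_max T : extend_filling T x = ord_max.
Proof.
rewrite ffunE insubF //=; apply/negbTE; by rewrite !inE eqxx.
Qed.

Let D_split (y : D) : y = x \/ exists y', y = incl y'.
Proof.
have [-> | neq] := eqVneq y x; [by left | right].
by exists [` in_D' neq]; apply: val_inj.
Qed.

Let extend_inj : injective extend_filling.
Proof.
move=> T1 T2 eqT; apply/ffunP => y; apply: val_inj => /=.
by rewrite -!extendE eqT.
Qed.

Let extend_standard T :
  standard_filling T -> standard_filling (extend_filling T).
Proof.
case/standard_fillingP=> injT posT incT.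
have lt_max y : extend_filling T (incl y) < extend_filling T x.
  by rewrite extendE extend_max /= cardD.
apply/standard_fillingP; split.
- move=> y z; case: (D_split y) => [->|[y' ->]]; case: (D_split z) => [->|[z' ->]] //.
  + by move=> eqT; have := lt_max z'; rewrite -eqT ltnn.
  + by move=> eqT; have := lt_max y'; rewrite eqT ltnn.
  + move=> /(congr1 val) /=; rewrite !extendE => eqT.
    by congr incl; apply/injT/val_inj.
- move=> y; case: (D_split y) => [->|[y' ->]]; last by rewrite extendE.
  by rewrite extend_max /= cardD.
- move=> y z; case: (D_split y) => [->|[y' ->]]; case: (D_split z) => [->|[z' ->]] //.
  + by case/maximal_cellP: maxx => _ /(_ _ x0D) /negbTE /= ->.
  + by case/maximal_cellP: maxx => _ /(_ _ (inclP z')) /negbTE /= ->.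
  + by move=> lexy; rewrite !extendE; exact: incT.
Qed.

Let restrict_standard (T : {ffun D -> 'I_#|` D|.+1}) :
  T x = ord_max -> standard_filling T ->
  standard_filling (restrict_filling T) /\
  extend_filling (restrict_filling T) = T.
Proof.
move=> Tx /standard_fillingP[injT posT incT].
(* By injectivity the maximum is taken only at [x], so the other values fit the smaller ordinal
   type. *)
have lt_max y : T (incl y) < #|` D'|.+1.
  rewrite -cardD ltn_neqAle -ltnS ltn_ord andbT.
  apply/eqP => eqT.
  have /injT /(congr1 val)/= eqyx : T (incl y) = T x by rewrite Tx; apply: val_inj.
  by have := valP y; rewrite !inE /= eqyx eqxx.
have restrE y : restrict_filling T y = T (incl y) :> nat.
  by rewrite ffunE inordK.
split.
  apply/standard_fillingP; split.
  - move=> y z /(congr1 val) /=; rewrite !restrE => /val_inj /injT /(congr1 val) /=.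
    exact: val_inj.
  - by move=> y; rewrite restrE.
  - by move=> y z lexy; rewrite !restrE; exact: incT.
apply/ffunP => y; case: (D_split y) => [->|[y' ->]]; first by rewrite extend_max.
by apply: val_inj; rewrite /= extendE restrE.
Qed.

Lemma card_fillings_max :
  #|[set T : {ffun D -> 'I_#|` D|.+1} | standard_filling T & T x == ord_max]|
    = num_fillings D'.
Proof.
rewrite /num_fillings -(card_imset _ extend_inj); apply: eq_card => T.
rewrite inE; apply/andP/imsetP => [[sT /eqP Tx] | [T']].
  have [sT' eT] := restrict_standard Tx sT.
  by exists (restrict_filling T); rewrite ?inE.
by rewrite inE => sT' ->; rewrite extend_standard // extend_max.
Qed.

End RemoveMaximal.

(** * The recursion on the position of the largest entry *)

Lemma num_fillings0 : num_fillings fset0 = 1.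
Proof.
have noD (x : (fset0 : {fset cell})) : False by case: x => x; rewrite inE.
pose T0 : {ffun (fset0 : {fset cell}) -> 'I_#|` (fset0 : {fset cell})|.+1} :=
  [ffun=> ord0].
rewrite /num_fillings; apply: etrans (cards1 T0).
apply: eq_card => T; rewrite !inE.
have -> : T = T0 by apply/ffunP => x; case: (noD x).
rewrite eqxx; apply/standard_fillingP.
by split=> [x | x | x]; case: (noD x).
Qed.

(** Double counting of pairs of a filling and the cell of its largest entry. Taking the maximal
    cells as a list [s] lets the sum unfold into explicit terms later. *)
Lemma num_fillings_rec (D : {fset cell}) (s : seq cell) :
  D != fset0 -> uniq s -> s =i maximal_cell D ->
  num_fillings D = \sum_(x <- s) num_fillings (D `\ x).
Proof.
move=> D0 us es.
rewrite big_seq.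
(* A bare cell [x] is not an element of the domain of [T]; the existential over [y : D] expresses
   that [x] holds the maximum without a membership proof. *)
transitivity (\sum_(x <- s | x \in s)
  #|[set T : {ffun D -> 'I_#|` D|.+1} | standard_filling T &
      [exists y : D, (val y == x) && (T y == ord_max)]]|); last first.
  apply: eq_bigr => x; rewrite es => maxx.
  rewrite -(card_fillings_max maxx); apply: eq_card => T; rewrite !inE.
  congr (_ && _); apply/existsP/idP => [[y /andP[/eqP eyx]] | Tx].
    by congr (T _ == _); apply: val_inj.
  by eexists; apply/andP; split; [|exact: Tx].
rewrite -big_seq /num_fillings.
under eq_bigr do rewrite -sum1_card big_mkcond.
rewrite exchange_big -sum1_card [LHS]big_mkcond; apply: eq_bigr => T _ /=.
under [RHS]eq_bigr do rewrite inE.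
rewrite inE; case: ifP => [sT | nsT]; last by rewrite big1.
(* For nonempty [D] the value [ord_max] is a genuine entry, hence attained, and its cell is maximal
   because no entry exceeds it. *)
have v0 : 0 < (ord_max : 'I_#|` D|.+1) by rewrite /= cardfs_gt0.
have [y Ty] := standard_filling_onto sT v0.
have /standard_fillingP[injT posT incT] := sT.
have ys : val y \in s.
  rewrite es; apply/maximal_cellP; split; first exact: valP.
  move=> z zD; apply/negP => /(incT y [` zD]).
  by rewrite Ty ltnNge -ltnS ltn_ord.
(* Exactly one cell of [s] contributes 1 for this [T]; injectivity makes all other terms vanish. *)
rewrite (bigD1_seq (val y)) //= big1 ?addn0.
  by case: ifP => // /existsP[]; exists y; rewrite Ty !eqxx.
move=> x neq; case: ifP => // /existsP[z /andP[/eqP ezx /eqP Tz]].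
by move: neq; rewrite -ezx -(injT _ _ (etrans Ty (esym Tz))) eqxx.
Qed.

(** * Shapes with three rows given by arbitrary lists of columns *)

Definition shape3 (r1 r2 r3 : seq nat) : {fset cell} :=
  [fset x in row_cells 1 r1 ++ row_cells 2 r2 ++ row_cells 3 r3].

Lemma mem_row_cells (i k j : nat) (r : seq nat) :
  ((k, j) \in row_cells i r) = (k == i) && (j \in r).
Proof.
apply/mapP/andP => [[j' j'r [-> ->]] | [/eqP -> jr]]; first by rewrite eqxx.
by exists j.
Qed.

Lemma mem_shape3 r1 r2 r3 (i j : nat) :
  ((i, j) \in shape3 r1 r2 r3) =
  [|| (i == 1) && (j \in r1), (i == 2) && (j \in r2) | (i == 3) && (j \in r3)].
Proof. by rewrite in_fset /= !mem_cat !mem_row_cells. Qed.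

Definition drop_last (r : seq nat) : seq nat := take (size r).-1 r.

Lemma drop_last_iota m n : drop_last (iota m n) = iota m n.-1.
Proof. by rewrite /drop_last size_iota take_iota; congr iota; lia. Qed.

Lemma last_iota1 n : 0 < n -> last 0 (iota 1 n) = n.
Proof. by case: n => // n _; rewrite -[n.+1]addn1 iotaD last_cat addnC. Qed.

Lemma mem_last_nonnil (r : seq nat) : r != [::] -> last 0 r \in r.
Proof. by case: r => //= x s _; rewrite mem_last. Qed.

Section SortedRow.
Variable r : seq nat.
Hypothesis sr : sorted ltn r.

Lemma leq_last_sorted j : j \in r -> j <= last 0 r.
Proof.
move: sr; case/lastP: r => // s x.
rewrite last_rcons mem_rcons inE => srt /predU1P[-> // | js].
move: srt; rewrite -cats1 sorted_pairwise; last exact: ltn_trans.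
by rewrite pairwise_cat allrel1r => /andP[/allP/(_ _ js)/ltnW].
Qed.

Lemma mem_drop_last j : (j \in drop_last r) = (j \in r) && (j != last 0 r).
Proof.
have: uniq r by apply: (sorted_uniq ltn_trans ltnn).
rewrite /drop_last; case/lastP: r => // s x.
rewrite size_rcons /= -cats1 take_size_cat // last_cat /= mem_cat inE.
rewrite cats1 rcons_uniq => /andP[xs _].
by have [-> | _] := eqVneq j x; rewrite ?(negbTE xs) ?andbF ?orbF ?andbT.
Qed.

End SortedRow.

(** Only the last cell of a row can be maximal, and it is so when its column is absent from all
    lower rows, not merely from the next one. Empty or blocked rows get the coefficient 0. *)
Lemma num_shape3_rec r1 r2 r3 :
  sorted ltn r1 -> sorted ltn r2 -> sorted ltn r3 ->
  [|| r1 != [::], r2 != [::] | r3 != [::]] ->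
  num_fillings (shape3 r1 r2 r3) =
    (((r1 != [::]) && (last 0 r1 \notin r2 ++ r3))
      * num_fillings (shape3 (drop_last r1) r2 r3)
    + ((r2 != [::]) && (last 0 r2 \notin r3))
      * num_fillings (shape3 r1 (drop_last r2) r3)
    + (r3 != [::]) * num_fillings (shape3 r1 r2 (drop_last r3)))%N.
Proof.
move=> sr1 sr2 sr3 r0.
set b1 := (r1 != [::]) && _; set b2 := (r2 != [::]) && _; set b3 := r3 != [::].
(* [nseq] of a boolean lists the end of a row once or not at all. *)
pose s : seq cell :=
  nseq b1 (1, last 0 r1) ++ nseq b2 (2, last 0 r2) ++ nseq b3 (3, last 0 r3).
have us : uniq s.
  by rewrite /s; case: (b1); case: (b2); case: (b3).
have es : s =i maximal_cell (shape3 r1 r2 r3).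
  move=> [i j]; rewrite !mem_cat !mem_nseq !lt0b.
  apply/idP/maximal_cellP.
    case/or3P=> /andP[bi /eqP[-> ->]]; (split;
      [rewrite mem_shape3 /= | case=> i' j'; rewrite mem_shape3]).
    - by rewrite mem_last_nonnil //; case/andP: bi.
    - move: bi; rewrite /b1 mem_cat negb_or => /and3P[_ n2 n3].
      case/or3P=> /andP[/eqP-> j'r]; rewrite /prec /= ?andbF ?orbF.
      + by rewrite -leqNgt leq_last_sorted.
      + by rewrite andbT; apply: contra n2 => /eqP->.
      + by rewrite andbT; apply: contra n3 => /eqP->.
    - by rewrite mem_last_nonnil //; case/andP: bi.
    - case/andP: bi => _ n3.
      case/or3P=> /andP[/eqP-> j'r]; rewrite /prec /= ?andbF ?orbF //.
      + by rewrite -leqNgt leq_last_sorted.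
      + by rewrite andbT; apply: contra n3 => /eqP->.
    - by rewrite mem_last_nonnil.
    - case/or3P=> /andP[/eqP-> j'r]; rewrite /prec /= ?andbF ?orbF //.
      by rewrite -leqNgt leq_last_sorted.
  (* Conversely, a maximal cell is compared with the end of its own row, then with the cells below
     it in column [j]. *)
  have nonempty (r : seq nat) : j \in r -> r != [::] by case: r.
  have is_last (r : seq nat) : sorted ltn r -> j \in r ->
      ~~ (j < last 0 r) -> j = last 0 r.
    move=> sr jr; rewrite -leqNgt => le_last.
    by apply/eqP; rewrite eqn_leq leq_last_sorted.
  rewrite mem_shape3 => -[/or3P[]/andP[/eqP-> jr] maxj].
  - have r1n := nonempty _ jr.
    have := maxj (1, last 0 r1); rewrite mem_shape3 /= mem_last_nonnil //=.
    move/(_ isT); rewrite /prec /= andbF orbF => /(is_last _ sr1 jr) ej.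
    apply/or3P; constructor 1; rewrite /b1 r1n -ej eqxx andbT /= mem_cat negb_or.
    apply/andP; split; apply/negP => jr'.
    + by have := maxj (2, j); rewrite mem_shape3 /prec /= jr' eqxx => /(_ isT).
    + by have := maxj (3, j); rewrite mem_shape3 /prec /= jr' eqxx => /(_ isT).
  - have r2n := nonempty _ jr.
    have := maxj (2, last 0 r2); rewrite mem_shape3 /= mem_last_nonnil //=.
    move/(_ isT); rewrite /prec /= andbF orbF => /(is_last _ sr2 jr) ej.
    apply/or3P; constructor 2; rewrite /b2 r2n -ej eqxx andbT /=.
    apply/negP => jr'.
    by have := maxj (3, j); rewrite mem_shape3 /prec /= jr' eqxx => /(_ isT).
  - have r3n := nonempty _ jr.
    have := maxj (3, last 0 r3); rewrite mem_shape3 /= mem_last_nonnil //=.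
    move/(_ isT); rewrite /prec /= andbF orbF => /(is_last _ sr3 jr) ej.
    by apply/or3P; constructor 3; rewrite /b3 r3n -ej eqxx.
have D0 : shape3 r1 r2 r3 != fset0.
  by apply/fset0Pn; case/or3P: r0 => /mem_last_nonnil ri;
    [exists (1, last 0 r1) | exists (2, last 0 r2) | exists (3, last 0 r3)];
    rewrite mem_shape3 ri ?orbT.
have big_nseqb (b : bool) (x : cell) F : \sum_(y <- nseq b x) F y = (b * F x)%N.
  by case: b; rewrite ?big_nil ?big_seq1 ?mul1n.
rewrite (num_fillings_rec D0 us es) !big_cat /= !big_nseqb addnA.
congr (_ * num_fillings _ + _ * num_fillings _ + _ * num_fillings _)%N;
  apply/fsetP => -[i j]; rewrite in_fsetD1 !mem_shape3 xpair_eqE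
    mem_drop_last //; case: eqP => [-> | _] //=; case: eqP => //=;
  by rewrite ?orbF ?andbT ?andbF //.
Qed.

(** * Left-justified rows: the hook formula and the closed forms of parts (1) and (2) *)

Local Open Scope ring_scope.

(** For left-justified rows the end of a row is free exactly when that row is longer than every
    lower one; the lengths need not decrease. *)
Lemma num_rows3_rec a b c : (0 < a + b + c)%N ->
  (num_fillings (rows3 a b c))%:R =
    ((b < a)%N && (c < a)%N)%:R * (num_fillings (rows3 a.-1 b c))%:R
    + (c < b)%:R * (num_fillings (rows3 a b.-1 c))%:R
    + (0 < c)%:R * (num_fillings (rows3 a b c.-1))%:R :> rat.
Proof.
move=> n0.
have iota0 n : (iota 1 n != [::]) = (0 < n)%N by case: n.
rewrite -[rows3 a b c]/(shape3 (iota 1 a) (iota 1 b) (iota 1 c)).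
rewrite num_shape3_rec ?iota_ltn_sorted ?iota0 //; last by lia.
rewrite !drop_last_iota mem_cat !mem_iota !natrD !natrM.
congr (_%:R * _ + _%:R * _ + _); congr nat_of_bool.
  by case: a n0 => // a _; rewrite last_iota1 //; lia.
by case: b n0 => // b _; rewrite last_iota1 //; lia.
Qed.

Lemma num_rows3_0 : num_fillings (rows3 0 0 0) = 1%N.
Proof.
rewrite -num_fillings0; congr num_fillings.
by apply/fsetP => x; rewrite in_fset !inE.
Qed.


Lemma natr_fact_neq0 n : n`!%:R != 0 :> rat.
Proof. by rewrite pnatr_eq0 -lt0n fact_gt0. Qed.

Lemma natr_factS n : n.+1`!%:R = (n%:R + 1) * n`!%:R :> rat.
Proof. by rewrite factS natrM natr1. Qed.

(** The hook formula in Frobenius form: with [l = (a + 2, b + 1, c)] the count is [n!] times the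
    product of the differences [l_i - l_j], [i < j], over the product of the [l_i!]. Induction is on
    the number of cells. *)
Lemma num_rows3_hook a b c : (c <= b <= a)%N ->
  (num_fillings (rows3 a b c))%:R =
    (a + b + c)`!%:R / (a.+2`!%:R * b.+1`!%:R * c`!%:R)
    * ((a%:R - b%:R + 1) * (b%:R - c%:R + 1) * (a%:R - c%:R + 2)) :> rat.
Proof.
move en: (a + b + c)%N => n.
elim: n a b c en => [|n IHn] a b c en /andP[cb ba].
  have [-> -> ->] : [/\ a = 0, b = 0 & c = 0]%N by split; lia.
  by rewrite num_rows3_0.
rewrite num_rows3_rec ?en //.
(* The three terms are brought over one prefactor. When a row end cannot be removed, the factor
   [a - b], [b - c] or [c] vanishes along with the boolean, so a single polynomial identity covers
   all cases. *)
have -> : ((b < a)%N && (c < a)%N)%:R * (num_fillings (rows3 a.-1 b c))%:R =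
    n`!%:R / (a.+2`!%:R * b.+1`!%:R * c`!%:R) * ((a%:R + 2)
    * ((a%:R - b%:R) * (b%:R - c%:R + 1) * (a%:R - c%:R + 1))) :> rat.
  have [lt_ba | ] := ltnP b a; last first.
    move=> ab; have -> : a = b by lia.
    by rewrite subrr !mul0r !mulr0.
  have -> /= : (c < a)%N by lia.
  case: a en ba lt_ba => // a en ba lt_ba; rewrite IHn /=; [|lia|lia].
  rewrite mul1r [a.+3`!]factS natrM; field.
  by rewrite !natr_fact_neq0 -natrD pnatr_eq0.
have -> : (c < b)%:R * (num_fillings (rows3 a b.-1 c))%:R =
    n`!%:R / (a.+2`!%:R * b.+1`!%:R * c`!%:R) * ((b%:R + 1)
    * ((a%:R - b%:R + 2) * (b%:R - c%:R) * (a%:R - c%:R + 2))) :> rat.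
  have [lt_cb | bc] := ltnP c b; last first.
    have -> : b = c by lia.
    by rewrite subrr !(mul0r, mulr0).
  case: b en cb ba lt_cb => // b en cb ba lt_cb; rewrite IHn /=; [|lia|lia].
  rewrite mul1r [b.+2`!]factS natrM; field.
  by rewrite !natr_fact_neq0 -natrD pnatr_eq0.
have -> : (0 < c)%:R * (num_fillings (rows3 a b c.-1))%:R =
    n`!%:R / (a.+2`!%:R * b.+1`!%:R * c`!%:R) * (c%:R
    * ((a%:R - b%:R + 1) * (b%:R - c%:R + 2) * (a%:R - c%:R + 3))) :> rat.
  case: c en cb => [|c] en cb; first by rewrite !(mul0r, mulr0).
  rewrite IHn /=; [|lia|lia].
  rewrite mul1r [c.+1`!]factS natrM; field.
  by rewrite !natr_fact_neq0 nat1r pnatr_eq0.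
have -> : n.+1`!%:R = (a%:R + b%:R + c%:R) * n`!%:R :> rat.
  by rewrite factS natrM -en !natrD.
by field; rewrite !natr_fact_neq0.
Qed.

(** Part (1) with [c = m - k], stated in [c] to allow induction on the third row. Row 1 is blocked
    by the longer row 2; shortening row 2 leaves a straight shape, shortening row 3 the induction
    hypothesis. *)
Lemma num_rows3_plus a c : (c <= a)%N ->
  (num_fillings (rows3 a a.+1 c))%:R =
    (2 * a + 1 + c)`!%:R / (a`!%:R * a.+1`!%:R * c`!%:R)
    * (((a%:R - c%:R + 2) ^+ 2 * (2 * a%:R + 1) + (a%:R + 2)) /
       ((a%:R + 1) * (a%:R + 2) * (2 * a%:R + 1) * (2 * a%:R + 3))) :> rat.
Proof.
have a0 := ler0n rat a.
elim: c => [|c IHc] ca; rewrite num_rows3_rec ?addn_gt0 ?orbT //.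
  rewrite ltnNge leqnSn !mul0r add0r addr0 mul1r num_rows3_hook ?leqnn //.
  have -> : (a + a + 0 = 2 * a)%N by lia.
  have -> : (2 * a + 1 + 0 = (2 * a).+1)%N by lia.
  rewrite [(2 * a).+1`!]factS [a.+2`!]factS [a.+1`!]factS !natrM fact0.
  field.
  rewrite !natr_fact_neq0.
  by rewrite /= ?andbT; repeat (apply/andP; split); apply: lt0r_neq0; lra.
have c0 := ler0n rat c.
rewrite ltnNge leqnSn !mul0r add0r ltnS ca !mul1r IHc 1?ltnW //=.
rewrite num_rows3_hook ?leqnn ?ca //.
have -> : (a + a + c.+1 = (2 * a + c).+1)%N by lia.
have -> : (2 * a + 1 + c = (2 * a + c).+1)%N by lia.
have -> : (2 * a + 1 + c.+1 = (2 * a + c).+2)%N by lia.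
rewrite [(2 * a + c).+2`!]factS [a.+2`!]factS [a.+1`!]factS [c.+1`!]factS !natrM.
field.
rewrite !natr_fact_neq0.
by rewrite /= ?andbT; repeat (apply/andP; split); apply: lt0r_neq0; lra.
Qed.

(** Part (2) with [m = p + 2], which avoids truncated subtraction. Row 2 is always blocked by row 3;
    removing the end of row 3 gives a straight shape, and removing that of row 1, possible for
    [k > 0], lowers [k]. The subtracted term does not depend on [k]: it cancels in the induction
    step and is fixed by the case [k = 0]. *)
Lemma num_rows3_gap p k :
  (num_fillings (rows3 (p.+2 + k) p.+1 p.+2))%:R =
    1 / ((2 * p%:R + 3) * (2 * p%:R + 1)) *
    (((k%:R + 2) ^+ 2 * (2 * p%:R + 1) + (p%:R + 2)) /
       ((p%:R + k%:R + 4) * (p%:R + k%:R + 3)) *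
       ((3 * p + 5 + k)`!%:R / ((p.+2 + k)`!%:R * p.+1`!%:R * p.+2`!%:R))
     - 3 / (3 * p%:R + 5) *
       ((3 * p + 5)`!%:R / (p.+3`!%:R * p`!%:R * p.+2`!%:R))) :> rat.
Proof.
have p0 := ler0n rat p.
(* The hook formula for the straight shape, with the factorial of [p + k' + 4] expanded down to that
   of [p + 2 + k'], the row length in the goal. *)
have hook k' : (num_fillings (rows3 (p.+2 + k') p.+1 p.+1))%:R =
    (3 * p + 4 + k')`!%:R
    / ((p%:R + k'%:R + 4) * (p%:R + k'%:R + 3) * (p.+2 + k')`!%:R
       * p.+2`!%:R * p.+1`!%:R) * ((k'%:R + 2) * (k'%:R + 3)) :> rat.
  have k0 := ler0n rat k'.
  rewrite num_rows3_hook; last by rewrite leqnn /= !addSn; lia.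
  have -> : (p.+2 + k' + p.+1 + p.+1 = 3 * p + 4 + k')%N by lia.
  set q := (p.+2 + k')%N; have qE : q%:R = p%:R + 2 + k'%:R :> rat.
    by rewrite natrD -addn2 natrD.
  have -> : q.+2`!%:R = (p%:R + k'%:R + 4) * (p%:R + k'%:R + 3) * q`!%:R :> rat.
    by rewrite !natr_factS -natr1 qE; ring.
  rewrite qE.
  field; rewrite !natr_fact_neq0.
  by rewrite /= ?andbT; repeat (apply/andP; split); apply: lt0r_neq0; lra.
elim: k => [|k IHk]; rewrite num_rows3_rec ?addn_gt0 ?orbT //.
  rewrite !addn0 ltnn andbF ltnNge leqnSn ltn0Sn !mul0r !add0r !mul1r.
  have := hook 0; rewrite !addn0 => ->.
  have -> : (3 * p + 5 = (3 * p + 4).+1)%N by lia.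
  rewrite [(3 * p + 4).+1`!]factS [p.+3`!]factS [p.+2`!]factS [p.+1`!]factS !natrM.
  field; rewrite !natr_fact_neq0.
  by rewrite /= ?andbT; repeat (apply/andP; split); apply: lt0r_neq0; lra.
have k0 := ler0n rat k.
have -> : (p.+1 < p.+2 + k.+1)%N && (p.+2 < p.+2 + k.+1)%N by lia.
rewrite [(p.+2 < _)%N]ltnNge leqnSn ltn0Sn mul0r addr0 !mul1r.
have -> : (p.+2 + k.+1).-1 = (p.+2 + k)%N by rewrite addnS.
rewrite IHk [p.+2.-1]/= hook.
have -> : (3 * p + 4 + k.+1 = (3 * p + 4 + k).+1)%N by lia.
have -> : (3 * p + 5 + k.+1 = (3 * p + 4 + k).+2)%N by lia.
have -> : (3 * p + 5 + k = (3 * p + 4 + k).+1)%N by lia.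
have -> : (p.+2 + k.+1 = (p.+2 + k).+1)%N by lia.
rewrite [(3 * p + 4 + k).+2`!%:R]natr_factS -[(3 * p + 4 + k).+1%:R]natr1.
rewrite [(3 * p + 4 + k).+1`!%:R]natr_factS [(p.+2 + k).+1`!%:R]natr_factS.
have -> : (3 * p + 4 + k)%:R = 3 * p%:R + 4 + k%:R :> rat by rewrite 2!natrD natrM.
have -> : (p.+2 + k)%:R = p%:R + 2 + k%:R :> rat by rewrite natrD -addn2 natrD.
rewrite [p.+3`!%:R]natr_factS [p.+2`!%:R]natr_factS [p.+1`!%:R]natr_factS.
field; rewrite !natr_fact_neq0.
by rewrite /= ?andbT; repeat (apply/andP; split); apply: lt0r_neq0; lra.
Qed.

(** * The shape with a hole: polynomial counts for part (3) *)

Definition hole3 (a : nat) (r2 : seq nat) (c : nat) : {fset cell} :=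
  shape3 (iota 1 a) r2 (iota 1 c).

Lemma num_hole3_rec a r2 c : sorted ltn r2 -> (0 < a)%N ->
  (num_fillings (hole3 a r2 c))%:R =
    (a \notin r2 ++ iota 1 c)%:R * (num_fillings (hole3 a.-1 r2 c))%:R
    + ((r2 != [::]) && (last 0%N r2 \notin iota 1 c))%:R
      * (num_fillings (hole3 a (drop_last r2) c))%:R
    + (0 < c)%:R * (num_fillings (hole3 a r2 c.-1))%:R :> rat.
Proof.
move=> sr2 a0; have iota0 n : (iota 1 n != [::]) = (0 < n)%N by case: n.
rewrite /hole3 num_shape3_rec ?iota_ltn_sorted ?iota0 ?a0 //.
by rewrite last_iota1 // !drop_last_iota !natrD !natrM.
Qed.

Lemma num_hole3_10 m : (num_fillings (hole3 m.+3 [:: 1%N] 0))%:R = m%:R + 3 :> rat.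
Proof.
have m0 := ler0n rat m.
rewrite -[hole3 _ _ _]/(rows3 m.+3 1 0) num_rows3_hook // !addn0.
have -> : (m.+3 + 1 = m.+4)%N by rewrite addn1.
rewrite [m.+4.+1`!%:R]natr_factS -[2`!]/2%N fact0; field; rewrite !natr_fact_neq0 /=.
by apply: lt0r_neq0; lra.
Qed.

Lemma num_hole3_11 a :
  (num_fillings (hole3 a.+1 [:: 1%N] 1))%:R = (a%:R + 1) * (a%:R + 2) / 2 :> rat.
Proof.
rewrite -[hole3 _ _ _]/(rows3 a.+1 1 1) num_rows3_hook //.
have -> : (a.+1 + 1 + 1 = a.+3)%N by lia.
by rewrite -[2`!]/2%N -[1`!]/1%N; field; rewrite natr_fact_neq0.
Qed.

(** Not a straight shape: (2, 1) is blocked by (3, 1), so only rows 1 and 3 can be shortened, and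
    row 1 only for [m > 0]. *)
Lemma num_hole3_12 m : (num_fillings (hole3 m.+2 [:: 1%N] 2))%:R =
  (m%:R + 2) * (m%:R + 3) * (m%:R + 4) / 6 - 1 :> rat.
Proof.
elim: m => [|m IHm]; rewrite num_hole3_rec //= num_hole3_11 ?IHm; first by field.
by rewrite /=; field.
Qed.

(** Here and for third rows of length 1 and 2, the cell (2, 3) is removable and leaves the middle
    row [[:: 1]]. Row 1 can be shortened only for [m > 0], as (2, 3) lies below (1, 3). *)
Lemma num_hole3_20 m : (num_fillings (hole3 m.+3 [:: 1; 3]%N 0))%:R =
  (m%:R ^+ 2 + 7 * m%:R + 6) / 2 :> rat.
Proof.
elim: m => [|m IHm]; rewrite num_hole3_rec //= num_hole3_10 ?IHm; by field.
Qed.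

Lemma num_hole3_21 m : (num_fillings (hole3 m.+3 [:: 1; 3]%N 1))%:R =
  (m%:R ^+ 3 + 12 * m%:R ^+ 2 + 38 * m%:R + 27) / 3 :> rat.
Proof.
elim: m => [|m IHm];
  rewrite num_hole3_rec //= num_hole3_11 num_hole3_20 ?IHm; by field.
Qed.

Lemma num_hole3_22 m : (num_fillings (hole3 m.+3 [:: 1; 3]%N 2))%:R =
  (m%:R ^+ 4 + 18 * m%:R ^+ 3 + 107 * m%:R ^+ 2 + 234 * m%:R + 144) / 8 :> rat.
Proof.
elim: m => [|m IHm];
  rewrite num_hole3_rec //= num_hole3_12 num_hole3_21 ?IHm; by field.
Qed.

(** Now (3, 3) blocks (2, 3), so each step in [m] adds just one value of the quartic of
    [num_hole3_22]. *)
Lemma num_hole3_23 m : (num_fillings (hole3 m.+3 [:: 1; 3]%N 3))%:R =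
  (m%:R + 5) * ((m%:R + 2) * (m%:R + 1)) * ((m%:R + 9) * (m%:R + 8)) / 40 :> rat.
Proof.
elim: m => [|m IHm]; rewrite num_hole3_rec //= num_hole3_22 ?IHm; by field.
Qed.

(** * Passage to the stated binomial and multinomial forms *)

Lemma natr_bin2 n : 'C(n.+2, 2)%:R = (n%:R + 2) * (n%:R + 1) / 2 :> rat.
Proof.
have : (2 * 'C(n.+2, 2) = n.+2 * n.+1)%N.
  (* Halving is exact, since a product of consecutive integers is even. *)
  by rewrite mul2n bin2 -[RHS]odd_double_half oddM /= negbK andbN.
by move/(congr1 (fun n => n%:R : rat)); rewrite !natrM => e; lra.
Qed.

Theorem theorem5p2 :
  (forall m k : nat, (1 <= m)%N -> (k <= m)%N ->
    (num_fillings (rows3 m m.+1 (m - k)))%:R =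
      multinomial3 (3 * m - k + 1) m (m + 1) (m - k) *
      (((k%:R + 2) ^+ 2 * (2 * m%:R + 1) + (m%:R + 2)) /
       ((m%:R + 1) * (m%:R + 2) * (2 * m%:R + 1) * (2 * m%:R + 3)))
    :> rat)
  /\
  (forall m k : nat, (2 <= m)%N ->
    (num_fillings (rows3 (m + k) (m - 1) m))%:R =
      1 / ((2 * m%:R - 1) * (2 * m%:R - 3)) *
      (((k%:R + 2) ^+ 2 * (2 * m%:R - 3) + m%:R) /
         ((m%:R + k%:R + 2) * (m%:R + k%:R + 1)) *
         multinomial3 (3 * m + k - 1) (m + k) (m - 1) m
       - 3 / (3 * m%:R - 1) *
         multinomial3 (3 * m - 1) (m + 1) (m - 2) m)
    :> rat)
  /\
  (forall m : nat,
    (num_fillings (rows3_hole (m + 3)))%:R =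
      (m%:R + 5) / 10 * 'C(m + 2, 2)%:R * 'C(m + 9, 2)%:R
    :> rat).
Proof.
split; [|split].
- move=> m k _ km; rewrite num_rows3_plus ?leq_subr // natrB //.
  have -> : (2 * m + 1 + (m - k) = 3 * m - k + 1)%N by lia.
  by rewrite /multinomial3 !addn1 opprB [m%:R + _]addrC subrK.
- case=> [|[|p]] // k _.
  rewrite /multinomial3.
  have -> : (3 * p.+2 + k - 1 = 3 * p + 5 + k)%N by lia.
  have -> : (3 * p.+2 - 1 = 3 * p + 5)%N by lia.
  have -> : (p.+2 - 1 = p.+1)%N by lia.
  have -> : (p.+2 - 2 = p)%N by lia.
  rewrite num_rows3_gap [(p.+2 + 1)%N]addn1.
  have -> : p.+2%:R = p%:R + 2 :> rat by rewrite -addn2 natrD.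
  (* Only affine coefficients remain to be matched, such as [2 * (p + 2) - 1] with [2 * p + 3]. *)
  congr (_ / (_ * _) * ((_ * _ + _) / (_ * _) * _ - _ / _ * _)); ring.
- move=> m; rewrite addn3 -[rows3_hole _]/(hole3 m.+3 [:: 1; 3]%N 3) num_hole3_23.
  have -> : (m + 9 = (m + 7).+2)%N by lia.
  by rewrite addn2 !natr_bin2 natrD; field.
Qed.
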